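(* Let $k$ be a field of characteristic zero and let $B$ be a normal affine $k$-domain with a nontrivial fundamental pair $(D,U)$. Set $E=[D,U]$ and let $A=\ker D$ with its induced $\mathbb{N}$-grading $A=\bigoplus_{d\in\mathbb{N}}A_d$ by $E$-eigenvalues, i.e. $A_d=\{f\in A : Ef=df\}$. (a) $(E,D,U)$ is a compatible triple for $B$ if and only if $A_2\neq\{0\}$. (b) $(D,U)$ is a compatible pair for $B$ if and only if $A_1\neq\{0\}$.
   Context: A $k$-domain is an integral domain containing $k$; it is affine if it is finitely generated as a $k$-algebra. $\mathrm{Der}_k(B)$ is the set of $k$-derivations of $B$. $D\in\mathrm{Der}_k(B)$ is locally nilpotent if for every $f\in B$ one has $D^nf=0$ for $n\gg 0$; $\mathrm{LND}(B)$ is the set of such derivations. A pair $(D,U)$ with $D,U\in\mathrm{LND}(B)$ is a fundamental pair for $B$ if $[D,[D,U]]=-2D$ and $[U,[D,U]]=2U$; it is nontrivial if $(D,U)\neq(0,0)$. (It is a fact that $\ker D$ is the direct sum of the spaces $A_d$, $d\ge 0$, and that this is an $\mathbb{N}$-grading of the ring $\ker D$.) $\mathbb{N}$ contains $0$. Compatible tuples. For $n\ge 2$, an $n$-tuple $(\theta_1,\dots,\theta_n)\in\mathrm{Der}_k(B)^n$ is compatible if and only if both of the following hold: (1) The subalgebra $k[\ker\theta_1,\ker\theta_2,\dots,\ker\theta_n]$ of $B$ generated by the kernels contains a nonzero ideal of $B$. (2) There is a triple $(G,\pi,\epsilon)$ where (i) $G$ is a rooted directed tree with orientation toward the root; (ii)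 $\pi:\mathrm{Vert}(G)\to\{\theta_1,\dots,\theta_n\}$ is a bijection with $\pi(\text{root})=\theta_1$; (iii) $\epsilon:\mathrm{Edge}(G)\to B$ is a map such that for every directed edge $(v,w)$ (from $v$ to $w$), $\epsilon(v,w)\in\left(\ker\pi(v)^2\setminus\ker\pi(v)\right)\cap\ker\pi(w)$ (in particular this set is nonempty). A compatible $2$-tuple is called a compatible pair, a compatible $3$-tuple a compatible triple. *)

(* Defs.v *)
From HB Require Import structures.
From mathcomp Require Import all_boot all_order all_algebra.
From mathcomp Require Import boolp classical_sets functions.

Set Implicit Arguments.
Unset Strict Implicit.
Unset Printing Implicit Defensive.

Import GRing.Theory.

Local Open Scope classical_set_scope.
Local Open Scope ring_scope.

(* Integral domains that are k-algebras. When k is a field, c |-> c%:A is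
   injective, so B contains a copy of k. *)
#[short(type="kDomainType")]
HB.structure Definition KDomain (k : nzRingType) :=
  {B of GRing.IntegralDomain B & GRing.ComUnitAlgebra k B}.

Section Domains.
Variables (k : fieldType) (B : kDomainType k).
Implicit Types (S I : set B) (D U : B -> B).

Definition generated_subalgebra S : set B :=
  smallest (fun C : set B => GRing.subalg_closed (mem C)) S.

Definition affine : Prop :=
  exists s : seq B, generated_subalgebra [set` s] = setT.

Definition normal_domain : Prop :=
  forall x : {fraction B},
    integralOver (@tofrac B) x -> exists b : B, x = tofrac b.

(* The library's idealr_closed is not used because it requires 1 \notin I. *)
Definition is_ideal I : Prop :=
  [/\ I 0, forall f g, I f -> I g -> I (f + g)
    & forall b f, I f -> I (b * f)].

Definition is_derivation D : Prop :=
  linear D /\ forall f g, D (f * g) = D f * g + f * D g.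

Definition kernel D : set B := [set f | D f = 0].

Definition locally_nilpotent D : Prop :=
  forall f, exists n, forall m, (n <= m)%N -> iter m D f = 0.

Definition LND D : Prop := is_derivation D /\ locally_nilpotent D.

Definition lie D U : B -> B := fun f => D (U f) - U (D f).

Definition fundamental_pair D U : Prop :=
  [/\ LND D, LND U,
      forall f, lie D (lie D U) f = (- 2%:R) *: D f
    & forall f, lie U (lie D U) f = 2%:R *: U f].

Definition nontrivial_pair D U : Prop :=
  ~ ((forall f, D f = 0) /\ (forall f, U f = 0)).

Definition graded_piece D U (d : nat) : set B :=
  [set f | kernel D f /\ lie D U f = d%:R *: f].

End Domains.

(* A digraph e is a rooted tree oriented toward r when no edge is a loop or is
   reversed by another edge, its underlying undirected graph is connected and
   acyclic, and every vertex has a directed path to r. *)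
Definition underlying (V : finType) (e : rel V) : rel V :=
  [rel v w | e v w || e w v].

Definition in_tree (V : finType) (e : rel V) (r : V) : Prop :=
  [/\ forall v w, e v w -> ~~ e w v,
      forall v w, connect (underlying e) v w,
      forall c : seq V, ucycle (underlying e) c -> (size c <= 2)%N
    & forall v, connect e v r].

(* The tuple has length m = n.+2, which encodes m >= 2. The labelling pi is a
   bijection onto the set of entries of theta; the map eps is only constrained
   on the edges of the tree, so its values at other pairs are irrelevant. *)
Definition compatible (k : fieldType) (B : kDomainType k) (n : nat)
    (theta : n.+2.-tuple (B -> B)) : Prop :=
  [/\ forall i, is_derivation (tnth theta i),
      exists I : set B,
        [/\ is_ideal I, (exists2 f, I f & f != 0)
          & I `<=` generated_subalgebra
                     (\bigcup_(i in [set: 'I_n.+2]) kernel (tnth theta i))]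
    & exists (V : finType) (e : rel V) (r : V)
             (pi : V -> (B -> B)) (eps : V -> V -> B),
        [/\ in_tree e r,
            set_bij [set: V] (range (tnth theta)) pi,
            pi r = thead theta
          & forall v w, e v w ->
              ((kernel (pi v \o pi v) `\` kernel (pi v)) `&` kernel (pi w))
                (eps v w)]].

(* Main.v *)
Require Import Defs.
From mathcomp Require Import all_boot all_order all_algebra.
From mathcomp Require Import boolp classical_sets functions.
From mathcomp Require Import ring zify.

(** Write [E = [D, U]] and let [A_d] be the space of vectors of weight [d] in
    [ker D]. The pair [(D, U)] is a locally nilpotent action of [sl_2] on [B]
    in which [D] raises the [E]-weight by 2 and [U] lowers it by 2, and weight
    considerations settle the conditions on the tree. If [f] is a nonzero
    element of [A_2], then [U f] has weight 0, is killed by [D^2] and [U^2]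
    but by neither [D] nor [U], so it labels both edges of the star with root
    [E]. If [f] is a nonzero element of [A_1], it labels the edge from [U] to
    [D]. Conversely any tree has an edge into its root, and its label yields a
    nonzero element of [A_2] or [A_1] ([weight2_of_D], [weight2_of_U],
    [weight1_of_U]).

    It remains to find a nonzero ideal of [B] inside the algebra [C] generated
    by the kernels. In both cases [g = U f] lies in [C] and is a local slice
    of [D], that is, [D g] is a nonzero element of [ker D]. Hence each element
    of [B] is carried into [C] by some power of [D g] ([slice_denominators]),
    and it suffices to bound this power, i.e. to show that [B] is a finite
    [C]-module.

    By complete reducibility ([string_decomp]), the affine algebra [B] is
    generated by finitely many strings [D^i w], [0 <= i <= n], where [w] is a
    lowest weight vector of weight [-n]. For [2p >= n], the alternating sum of
    the products [D^i w * D^(2p-i) w] is killed by [D], hence lies in [C]; so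
    the square of [D^p w] is, modulo [C], a combination of products [D^i w *
    D^j w] with [i + j = 2p] and [i <> p] ([string_square]). For [2p < n] the
    same holds with [D] and [U] exchanged. Each such substitution increases
    the sum of the squared indices of a monomial, which is bounded in each
    degree, or lowers its degree. So the rewriting terminates, and [B] is
    spanned over [C] by the finitely many squarefree monomials in the string
    vectors ([bounded_denominators]). Therefore [(D g)^N B] is contained in
    [C] for some [N]. *)

Set Implicit Arguments.
Unset Strict Implicit.
Unset Printing Implicit Defensive.

Import GRing.Theory.

Local Open Scope classical_set_scope.
Local Open Scope ring_scope.

(** * Linear maps and derivations *)

Section LinearMaps.
Context {k : fieldType} {B : kDomainType k}.
Implicit Types (f D : B -> B) (a : k) (u v : B).

Lemma linD f : linear f -> {morph f : u v / u + v}.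
Proof. by move=> lf u v; have := lf 1 u v; rewrite !scale1r. Qed.

Lemma lin0 f : linear f -> f 0 = 0.
Proof. by move=> lf; apply: (addrI (f 0)); rewrite -(linD lf) !addr0. Qed.

Lemma linZ f : linear f -> forall a u, f (a *: u) = a *: f u.
Proof. by move=> lf a u; have := lf a u 0; rewrite (lin0 lf) !addr0. Qed.

Lemma linN f : linear f -> {morph f : u / - u}.
Proof. by move=> lf u; rewrite -!scaleN1r (linZ lf). Qed.

Lemma linB f : linear f -> {morph f : u v / u - v}.
Proof. by move=> lf u v; rewrite (linD lf) (linN lf). Qed.

Lemma lin_sum f : linear f -> forall (I : Type) (r : seq I) (F : I -> B),
  f (\sum_(i <- r) F i) = \sum_(i <- r) f (F i).
Proof.
move=> lf I r F; elim: r => [|i r IH]; first by rewrite !big_nil (lin0 lf).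
by rewrite !big_cons (linD lf) IH.
Qed.

Lemma lin_iter f n : linear f -> linear (iter n f).
Proof. by move=> lf; elim: n => [|n IH] a u v //=; rewrite IH lf. Qed.

Lemma iter0_le f n m v : linear f -> (n <= m)%N -> iter n f v = 0 -> iter m f v = 0.
Proof.
move=> lf /subnK <- h; rewrite iterD h.
by apply: lin0; apply: lin_iter.
Qed.

Lemma der_lin D : is_derivation D -> linear D.
Proof. by case. Qed.

Lemma derX D (g : B) n : is_derivation D ->
  D (g ^+ n.+1) = n.+1%:R * g ^+ n * D g.
Proof.
move=> [lD dM]; elim: n => [|n IH]; first by rewrite expr1 expr0 !mul1r.
by rewrite exprS dM IH -[in RHS]natr1 (exprS g n); ring.
Qed.

Lemma der_kerM D (a b : B) : is_derivation D -> D a = 0 -> D b = 0 -> D (a * b) = 0.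
Proof. by move=> [_ dM] a0 b0; rewrite dM a0 b0 mul0r mulr0 addr0. Qed.

Lemma der_kerX D (g : B) n : is_derivation D -> D g = 0 -> D (g ^+ n) = 0.
Proof.
move=> dD g0; elim: n => [|n IH].
  have := proj2 dD 1 1; rewrite !mulr1 mul1r expr0 => h.
  by apply: (addrI (D 1)); rewrite -h addr0.
by rewrite exprS; apply: der_kerM.
Qed.

Lemma der_iterKM D (a b : B) n : is_derivation D -> D a = 0 ->
  iter n D (a * b) = a * iter n D b.
Proof.
move=> dD a0; elim: n => [|n IH] //=.
by rewrite IH (proj2 dD) a0 mul0r add0r.
Qed.

(** The powers of a local slice [g] are divided powers up to factorials:
    [D^n] sends [g^n * a] to [n! (D g)^n a]. *)
Lemma iter_slice D (g a : B) n : is_derivation D ->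
  D (D g) = 0 -> D a = 0 ->
  iter n D (g ^+ n * a) = n`!%:R * D g ^+ n * a.
Proof.
move=> dD sg a0; elim: n => [|n IH]; first by rewrite !expr0 !mul1r.
have e : D (g ^+ n.+1 * a) = (n.+1%:R * D g) * (g ^+ n * a).
  by rewrite (proj2 dD) derX // a0 mulr0 addr0; ring.
rewrite iterSr e der_iterKM //; last first.
  by rewrite mulr_natl -scaler_nat linZ ?sg ?scaler0 //; apply: der_lin.
by rewrite IH factS natrM exprS; ring.
Qed.

End LinearMaps.

(** * Subspaces and subalgebras *)

Section Submodules.
Context {k : fieldType} {B : kDomainType k}.
Implicit Types (P C : set B).

Lemma submodE P : GRing.submod_closed (mem P) ->
  P 0 /\ forall (a : k) u v, P u -> P v -> P (a *: u + v).
Proof.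
case=> P0 Pl; split=> [|a u v Pu Pv]; first exact: set_mem P0.
by apply: set_mem; apply: Pl; apply: mem_set.
Qed.

Lemma submodI P : P 0 -> (forall (a : k) u v, P u -> P v -> P (a *: u + v)) ->
  GRing.submod_closed (mem P).
Proof.
move=> P0 Pl; split=> [|a u v /set_mem Pu /set_mem Pv]; first exact: mem_set.
by apply: mem_set; apply: Pl.
Qed.

Lemma submodD P u v : GRing.submod_closed (mem P) -> P u -> P v -> P (u + v).
Proof. by case/submodE => _ Pl Pu Pv; rewrite -[u]scale1r; apply: Pl. Qed.

Lemma submodZ P (a : k) u : GRing.submod_closed (mem P) -> P u -> P (a *: u).
Proof. by case/submodE => P0 Pl Pu; rewrite -[_ *: _]addr0; apply: Pl. Qed.

Lemma submodN P u : GRing.submod_closed (mem P) -> P u -> P (- u).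
Proof. by move=> sP Pu; rewrite -scaleN1r; apply: submodZ. Qed.

Lemma submod_sum P (I : eqType) (r : seq I) (p : pred I) (F : I -> B) :
  GRing.submod_closed (mem P) -> (forall i, i \in r -> p i -> P (F i)) ->
  P (\sum_(i <- r | p i) F i).
Proof.
move=> sP PF; rewrite big_seq_cond; apply: (big_ind P).
- by case: (submodE sP).
- by move=> u v; apply: submodD.
- by move=> i /andP[]; apply: PF.
Qed.

Lemma subalgE C : GRing.subalg_closed (mem C) ->
  [/\ C 1, forall (a : k) u v, C u -> C v -> C (a *: u + v)
    & forall u v, C u -> C v -> C (u * v)].
Proof.
case=> C1 Cl CM; split=> [|a u v Cu Cv|u v Cu Cv]; first exact: set_mem C1.
  by apply: set_mem; apply: Cl; apply: mem_set.
by apply: set_mem; apply: CM; apply: mem_set.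
Qed.

Lemma subalgI C : C 1 -> (forall (a : k) u v, C u -> C v -> C (a *: u + v)) ->
  (forall u v, C u -> C v -> C (u * v)) -> GRing.subalg_closed (mem C).
Proof.
move=> C1 Cl CM; split; first exact: mem_set.
  by move=> a u v /set_mem Cu /set_mem Cv; apply: mem_set; apply: Cl.
by move=> u v /set_mem Cu /set_mem Cv; apply: mem_set; apply: CM.
Qed.

Lemma subalg_submod C : GRing.subalg_closed (mem C) -> GRing.submod_closed (mem C).
Proof.
move=> /subalgE[C1 Cl _]; apply: submodI => //.
by rewrite -(subrr 1) addrC -scaleN1r; apply: Cl.
Qed.

Lemma subalgX C u n : GRing.subalg_closed (mem C) -> C u -> C (u ^+ n).
Proof.
move=> /subalgE[C1 _ CM] Cu; elim: n => [|n IH]; first by rewrite expr0.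
by rewrite exprS; apply: CM.
Qed.

Lemma generated_subalgebra_closed (S : set B) :
  GRing.subalg_closed (mem (generated_subalgebra S)).
Proof.
apply: subalgI => [A [/subalgE[] //]|a u v hu hv A hA|u v hu hv A hA].
  by case: (hA) => /subalgE[_ Al _] _; apply: Al; [apply: hu | apply: hv].
by case: (hA) => /subalgE[_ _ AM] _; apply: AM; [apply: hu | apply: hv].
Qed.

End Submodules.

(** * Locally nilpotent representations of sl_2 *)

Section Sl2.
Context {k : fieldType} {B : kDomainType k}.
Implicit Types (D U : B -> B) (a l : k) (b u v w : B).

Lemma scale_natr n v : (n%:R : k) *: v = n%:R * v.
Proof. by rewrite scaler_nat -[LHS]mulr_natl. Qed.

Lemma lie_sym D U v : lie U D v = - lie D U v.
Proof. by rewrite /lie opprB. Qed.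

Lemma lie_lin D U : linear D -> linear U -> linear (lie D U).
Proof.
move=> lD lU a u v; rewrite /lie lU lD lD lU.
by rewrite scalerBr opprD addrACA.
Qed.

Lemma lie_derivation D U :
  is_derivation D -> is_derivation U -> is_derivation (lie D U).
Proof.
move=> [lD mD] [lU mU]; split; first exact: lie_lin.
by move=> u v; rewrite /lie mU mD (linD lD) (linD lU) !mD !mU; ring.
Qed.

Lemma fundamental_pair_sym D U : fundamental_pair D U -> fundamental_pair U D.
Proof.
move=> [hD hU h1 h2]; have lD := der_lin (proj1 hD); have lU := der_lin (proj1 hU).
have e V f : linear V -> lie V (lie U D) f = - lie V (lie D U) f.
  by move=> lV; rewrite /lie !(linB lV); ring.
split=> // f; first by rewrite e // h2 scaleNr.
by rewrite e // h1 scaleNr opprK.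
Qed.

(** [w] is a lowest weight vector of weight [-l] for the action of [sl_2] in
    which [D] raises, [U] lowers and [lie D U] is the semisimple element. *)
Definition lowest_weight D U l w : Prop := U w = 0 /\ lie D U w = - l *: w.

Section Pair.
Variables (D U : B -> B).
Hypothesis DU : fundamental_pair D U.
Local Notation E := (lie D U).

Let dD : is_derivation D. Proof. by case: DU => [[]]. Qed.
Let dU : is_derivation U. Proof. by case: DU => _ []. Qed.
Let lD : linear D := der_lin dD.
Let lU : linear U := der_lin dU.
Let lE : linear E := lie_lin lD lU.

Lemma lie_D v : E (D v) = D (E v) + 2%:R *: D v.
Proof.
case: DU => _ _ h _; have := h v; rewrite {1}/lie scaleNr => e.
by rewrite -[2%:R *: D v]opprK -e opprB addrC subrK.
Qed.

Lemma lie_U v : E (U v) = U (E v) - 2%:R *: U v.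
Proof.
case: DU => _ _ _ h; have := h v; rewrite {1}/lie => <-.
by rewrite opprB addrC subrK.
Qed.

Lemma U_D v : U (D v) = D (U v) - E v.
Proof. by rewrite /lie opprB addrC subrK. Qed.

Lemma lie_iterD l w i : lowest_weight D U l w ->
  E (iter i D w) = (i.*2%:R - l) *: iter i D w.
Proof.
move=> [_ Ew]; elim: i => [|i IH]; first by rewrite /= sub0r.
rewrite iterS lie_D IH (linZ lD) -scalerDl; congr (_ *: _).
by rewrite doubleS -[in RHS]addn2 natrD; ring.
Qed.

Lemma U_iterD l w i : lowest_weight D U l w ->
  U (iter i.+1 D w) = (i.+1%:R * (l - i%:R)) *: iter i D w.
Proof.
move=> hw; elim: i => [|i IH].
  case: hw => Uw Ew; rewrite /= U_D Uw (lin0 lD) Ew sub0r scaleNr opprK.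
  by congr (_ *: _); ring.
rewrite iterS U_D IH (lie_iterD _ hw) (linZ lD) -scalerBl; congr (_ *: _).
by rewrite -!muln2 !natrM -!natr1; ring.
Qed.

Lemma iterU_iterD l w j : lowest_weight D U l w ->
  iter j U (iter j D w) = (\prod_(i < j) (i.+1%:R * (l - i%:R))) *: w.
Proof.
move=> hw; elim: j => [|j IH]; first by rewrite big_ord0 scale1r.
rewrite iterSr (U_iterD _ hw) (linZ (lin_iter j lU)) IH scalerA.
by rewrite big_ord_recr /= mulrC.
Qed.

Lemma commute_iterU_D m b :
  iter m.+1 U (D b) =
  D (iter m.+1 U b) - m.+1%:R *: (E (iter m U b) + m%:R *: iter m U b).
Proof.
elim: m => [|m IH]; first by rewrite /= U_D scale0r addr0 scale1r.
rewrite iterS IH (linB lU) (linZ lU) (linD lU) (linZ lU) U_D.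
have -> : U (E (iter m U b)) = E (iter m.+1 U b) + 2%:R *: iter m.+1 U b.
  by rewrite /= lie_U subrK.
by rewrite -!iterS !scale_natr; ring.
Qed.

Lemma lowest_weightZ l a w :
  lowest_weight D U l w -> lowest_weight D U l (a *: w).
Proof.
move=> [Uw Ew]; split; first by rewrite (linZ lU) Uw scaler0.
by rewrite (linZ lE) Ew !scalerA mulrC.
Qed.

Hypothesis hk : [pchar k] =i pred0.

Let natr_eq0 n : (n%:R == 0 :> k) = (n == 0%N).
Proof. by move: n; apply/pcharf0P. Qed.

Let subr_nat_neq0 m n : m != n -> (m%:R - n%:R : k) != 0.
Proof.
case: ltngtP => // [mn|nm] _.
  by rewrite -opprB -natrB 1?ltnW // oppr_eq0 natr_eq0 subn_eq0 -ltnNge.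
by rewrite -natrB 1?ltnW // natr_eq0 subn_eq0 -ltnNge.
Qed.

(** A lowest weight vector of weight [-n] generates a module of dimension at
    most [n + 1]. *)
Lemma string_end n w : lowest_weight D U n%:R w -> iter n.+1 D w = 0.
Proof.
move=> hw; set v := iter n.+1 D w.
have hv : lowest_weight D U (- n.+2%:R) v.
  split; first by rewrite /v (U_iterD _ hw) subrr mulr0 scale0r.
  rewrite /v (lie_iterD _ hw); congr (_ *: _).
  by rewrite opprK -muln2 natrM -!natr1; ring.
case: DU => [[_ nD] _ _ _]; have [N hN] := nD v.
have := iterU_iterD N hv; rewrite (hN N (leqnn N)) (lin0 (lin_iter N lU)) => /esym/eqP.
rewrite scaler_eq0 => /orP[|/eqP //]; rewrite prodf_seq_eq0 => /hasP[i _ /= ].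
rewrite mulf_eq0 natr_eq0 /= -opprD oppr_eq0 -natrD natr_eq0.
by rewrite addSn.
Qed.

Lemma string_coef_neq0 n j : (j <= n)%N ->
  \prod_(i < j) (i.+1%:R * (n%:R - i%:R)) != 0 :> k.
Proof.
move=> jn; apply/prodf_neq0 => i _.
rewrite mulf_neq0 ?natr_eq0 // subr_nat_neq0 //.
by rewrite gtn_eqF // (leq_trans (ltn_ord i)).
Qed.

(** If [U] kills [U^m b], then [U^m b] is a sum of weight vectors of weights at
    most [-m].  The induction passes from [b] to [D b]: by [commute_iterU_D],
    [U^(m+1) (D b)] is [-(m+1) (E + m) (U^m b)]. *)
Lemma lowest_weight_decomp N m b : iter m.+1 U b = 0 -> iter N D b = 0 ->
  exists L : seq (nat * B),
    (forall x, x \in L -> (m <= x.1)%N /\ lowest_weight D U x.1%:R x.2) /\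
    iter m U b = \sum_(x <- L) x.2.
Proof.
elim: N m b => [|N IH] m b Ub Db.
  by exists [::]; split=> //; rewrite big_nil -[RHS](lin0 (lin_iter m lU)) -Db.
set w := iter m U b; have Uw : U w = 0 by [].
have e := commute_iterU_D m b; rewrite Ub (lin0 lD) sub0r -/w in e.
have UEw : U (E w) = 0.
  by have := lie_U w; rewrite Uw (lin0 lE) scaler0 subr0.
have [| |L [hL sL]] := IH m.+1 (D b).
- rewrite iterS e (linN lU) (linZ lU) (linD lU) (linZ lU) Uw UEw.
  by rewrite scaler0 addr0 scaler0 oppr0.
- by rewrite -iterSr.
(* The coefficients are chosen so that [E + m] takes the same value on [h] and
   on [w]; then [w - h] has weight [-m]. *)
pose a (x : nat * B) : k := (m.+1%:R * (x.1%:R - m%:R))^-1.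
pose h := \sum_(x <- L) a x *: x.2.
have Uh : U h = 0.
  rewrite /h (lin_sum lU) big_seq big1 // => x /hL [_ [Ux _]].
  by rewrite (linZ lU) Ux scaler0.
have Eh : m.+1%:R *: (E h + m%:R *: h) = - \sum_(x <- L) x.2.
  rewrite /h (lin_sum lE) scaler_sumr -big_split /= scaler_sumr -sumrN.
  rewrite big_seq [RHS]big_seq; apply: eq_bigr => x /hL [mx [_ Ex]].
  rewrite (linZ lE) Ex !scalerA -scalerDl scalerA -scaleN1r; congr (_ *: _).
  have n1 : m.+1%:R != 0 :> k by rewrite natr_eq0.
  have n2 : x.1%:R - m%:R != 0 :> k by rewrite subr_nat_neq0 // gtn_eqF.
  have -> : a x * - x.1%:R + m%:R * a x = - ((x.1%:R - m%:R) * a x) by ring.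
  rewrite /a.
  move: (m.+1%:R : k) (x.1%:R - m%:R : k) n1 n2 => c t c0 t0.
  by field; rewrite c0 t0.
have hwh : lowest_weight D U m%:R (w - h).
  split; first by rewrite (linB lU) Uw Uh subrr.
  apply/eqP; rewrite scaleNr -addr_eq0; apply/eqP.
  have /eqP : m.+1%:R *: (E (w - h) + m%:R *: (w - h)) = 0.
    rewrite (linB lE) (scalerBr m%:R) addrACA -opprD scalerBr Eh -sL e.
    by rewrite opprK subrr.
  by rewrite scaler_eq0 natr_eq0 /= => /eqP.
exists ((m, w - h) :: [seq (x.1, a x *: x.2) | x <- L]); split; last first.
  by rewrite big_cons big_map /= -/h subrK.
move=> x; rewrite inE => /orP[/eqP -> //|/mapP[y /hL [my hy] ->]] /=.
by split; [exact: ltnW | exact: lowest_weightZ].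
Qed.

(** Complete reducibility: every [b] is a combination of the vectors [D^i w],
    where [w] runs over finitely many lowest weight vectors.  The span is
    expressed by its universal property among linear subspaces. *)
Lemma string_decomp b :
  exists L : seq (nat * B),
    (forall x, x \in L -> lowest_weight D U x.1%:R x.2) /\
    (forall P : set B, GRing.submod_closed (mem P) ->
       (forall x i, x \in L -> P (iter i D x.2)) -> P b).
Proof.
have [m Um] : exists m, iter m U b = 0.
  by case: DU => [_ [_ nU] _ _]; have [m hm] := nU b; exists m; apply: hm.
elim: m b Um => [|m IH] b Um.
  by exists [::]; split=> // P /submodE[P0 _] _; rewrite -[b]/(iter 0 U b) Um.
have [N DN] : exists N, iter N D b = 0.
  by case: DU => [[_ nD] _ _ _]; have [n hn] := nD b; exists n; apply: hn.
have [L [hL sL]] := lowest_weight_decomp Um DN.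
(* [U^m (D^m w)] is a nonzero multiple of each component [w] of [U^m b], so
   subtracting suitable multiples of the [D^m w] from [b] lowers [m]. *)
pose c (x : nat * B) : k := (\prod_(i < m) (i.+1%:R * (x.1%:R - i%:R)))^-1.
have [|L1 [hL1 PL1]] := IH (b - \sum_(x <- L) c x *: iter m D x.2).
  rewrite (linB (lin_iter m lU)) (lin_sum (lin_iter m lU)) sL -sumrB.
  rewrite big_seq big1 // => x /hL [mx hx].
  rewrite (linZ (lin_iter m lU)) (iterU_iterD _ hx) scalerA /c.
  by rewrite mulVf ?string_coef_neq0 // scale1r subrr.
exists (L ++ L1); split.
  by move=> x; rewrite mem_cat => /orP[/hL []|/hL1].
move=> P sP hP.
have [P0 Pl] := submodE sP.
have PL : P (\sum_(x <- L) c x *: iter m D x.2).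
  rewrite big_seq; apply: (big_ind P) => //.
    by move=> u v Pu Pv; rewrite -[u]scale1r; apply: Pl.
  move=> x xL; rewrite -[_ *: _]addr0; apply: Pl => //; apply: hP.
  by rewrite mem_cat xL.
have P1 := PL1 P sP; rewrite -[b](subrK (\sum_(x <- L) c x *: iter m D x.2)).
rewrite -[X in X + _]scale1r; apply: Pl => //; apply: P1 => x i xL.
by apply: hP; rewrite mem_cat xL orbT.
Qed.

End Pair.
End Sl2.

(** * Finiteness over a subalgebra *)

Section Denominators.
Context {k : fieldType} {B : kDomainType k}.
Implicit Types (P C : set B).

(** Modulo [ker d], the square of the [p]-th vector of a string [d^i v],
    [i <= n <= 2p], is a combination of products of two vectors of the string
    placed symmetrically on both sides of [p]: the alternating sum of the
    [d^i v * d^(2p-i) v] is in [ker d]. *)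
Lemma string_square (d : B -> B) v n p P y : is_derivation d ->
  iter n.+1 d v = 0 -> (n <= p.*2)%N -> GRing.submod_closed (mem P) ->
  (forall c, d c = 0 -> P (c * y)) ->
  (forall i j, (i <= n)%N -> (j <= n)%N -> (i + j = p.*2)%N -> i != p ->
     P (iter i d v * iter j d v * y)) ->
  P (iter p d v * iter p d v * y).
Proof.
move=> dd vn np sP Pker Pij; have ld := der_lin dd.
pose q := \sum_(0 <= i < p.*2.+1) (-1) ^+ i *: (iter i d v * iter (p.*2 - i) d v).
have v0 m : (n < m)%N -> iter m d v = 0 by move=> h; apply: iter0_le vn.
have dq : d q = 0.
  pose t i := (-1) ^+ i *: (iter i d v * iter (p.*2.+1 - i) d v).
  transitivity (- \sum_(0 <= i < p.*2.+1) (t i.+1 - t i)).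
    rewrite /q (lin_sum ld) -sumrN !big_nat; apply: eq_bigr => i /andP[_ ip].
    rewrite (linZ ld) (proj2 dd) /t subSS subSn // exprS mulN1r scaleNr.
    by rewrite opprB opprK scalerDr addrC.
  rewrite telescope_sumr // /t subnn subn0 (v0 p.*2.+1) ?ltnS //.
  by rewrite mul0r mulr0 !scaler0 subrr oppr0.
have -> : iter p d v * iter p d v * y = (-1) ^+ p *: (q * y -
    \sum_(i < p.*2.+1 | i != p :> nat)
      (-1) ^+ i *: (iter i d v * iter (p.*2 - i) d v * y)).
  have pp : (p < p.*2.+1)%N by rewrite ltnS -addnn leq_addr.
  rewrite /q big_mkord (bigD1 (Ordinal pp)) //= mulrDl mulr_suml.
  rewrite (eq_bigl (fun i : 'I_(p.*2.+1) => i != p :> nat)) //.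
  under [X in _ + X - _]eq_bigr do rewrite -scalerAl.
  rewrite addrK -scalerAl scalerA -(expr2 ((-1) ^+ p)) sqrr_sign scale1r.
  by rewrite -addnn addnK.
apply: submodZ => //; apply: submodD => //; first exact: Pker.
apply: submodN => //; apply: submod_sum => // i _ ip; apply: submodZ => //.
have ip2 : (i <= p.*2)%N by rewrite -ltnS.
have [ni|ni] := ltnP n i.
  by rewrite (v0 _ ni) !mul0r; case: (submodE sP).
have [nj|nj] := ltnP n (p.*2 - i).
  by rewrite (v0 _ nj) mulr0 mul0r; case: (submodE sP).
by apply: Pij => //; rewrite subnKC.
Qed.

Lemma not_uniq_perm (T : eqType) (s : seq T) : ~~ uniq s ->
  exists x s', perm_eq s [:: x, x & s'].
Proof.
elim: s => //= a s IH; rewrite negb_and negbK => /orP[/perm_to_rem as_|/IH].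
  by exists a, (rem a s); rewrite perm_cons.
case=> x [s' ss']; exists x, (a :: s').
rewrite (perm_trans (y := a :: [:: x, x & s'])) ?perm_cons //.
by rewrite -[_ :: _]/([:: a] ++ [:: x; x] ++ s') perm_catCA.
Qed.

(** If [B] is generated by finitely many [X j] whose squares are, modulo [C],
    combinations of products of two generators of larger total rank, then the
    squarefree monomials in the [X j] span [B] as a [C]-module.  Hence if each
    [X j] has some power of [f] as a denominator over [C], one power of [f] is
    a denominator for all of [B]. *)
Lemma bounded_denominators (J : finType) (X : J -> B) (rk : J -> nat) C (f : B) :
  GRing.subalg_closed (mem C) -> C f -> (forall j, exists N, C (f ^+ N * X j)) ->
  (forall j P y, GRing.submod_closed (mem P) ->
     (forall c, C c -> P (c * y)) ->
     (forall i i', ((rk j).*2 < rk i + rk i')%N -> P (X i * X i' * y)) ->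
     P (X j * X j * y)) ->
  (forall R : set B, GRing.subalg_closed (mem R) -> (forall j, R (X j)) ->
     forall b, R b) ->
  exists N, forall b, C (f ^+ N * b).
Proof.
move=> sC Cf fX sq gen.
have [C1 Cl CM] := subalgE sC.
have [N CN] := fin_all_exists fX.
pose M := (\sum_j N j)%N; pose P : set B := [set b | C (f ^+ M * b)].
have sP : GRing.submod_closed (mem P).
  apply: submodI => [|a u v Pu Pv]; rewrite /P /=.
    by rewrite mulr0; case: (submodE (subalg_submod sC)).
  by rewrite mulrDr -scalerAr; apply: Cl.
have CP c y : C c -> P y -> P (c * y).
  by move=> Cc Py; rewrite /P /= mulrCA; apply: CM.
have Puniq s : uniq s -> P (\prod_(j <- s) X j).
  move=> us; rewrite /P /= /M (bigID (mem s)) /= exprD mulrAC -!prodrXr.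
  rewrite (big_uniq _ us) /= -big_split /=; apply: (CM).
    by apply: (big_ind C C1 CM) => j _; apply: CN.
  by apply: (big_ind C C1 CM) => j _; apply: subalgX.
pose K := (\sum_j rk j)%N.
have rkK j : (rk j <= K)%N by rewrite /K (bigD1 j) //= leq_addr.
(* Both replacing a pair by one of larger total rank and deleting a pair lower
   this measure, since every factor contributes at least 1. *)
pose mu s := (\sum_(j <- s) (K.+1 - rk j))%N.
have Pmon m s : (mu s <= m)%N -> P (\prod_(j <- s) X j).
  elim/ltn_ind: m s => m IH s sm.
  have [us|nus] := boolP (uniq s); first exact: Puniq.
  have [x [s' ss']] := not_uniq_perm nus.
  rewrite (perm_big _ ss') /= !big_cons mulrA.
  have mus : mu s = ((K.+1 - rk x) + ((K.+1 - rk x) + mu s'))%N.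
    by rewrite /mu (perm_big _ ss') /= !big_cons.
  have xK := rkK x.
  apply: sq => // [c Cc|i i' ii'].
    by apply: CP => //; apply: (IH (mu s')) => //; lia.
  have iK := rkK i; have iK' := rkK i'.
  have := IH (mu [:: i, i' & s']) _ [:: i, i' & s'] (leqnn _).
  rewrite !big_cons mulrA; apply.
  by rewrite /mu !big_cons -/(mu s'); lia.
(* [R] is a subalgebra: the multiplier algebra of [Q]. *)
pose Q : set B := [set y | forall s, P ((\prod_(j <- s) X j) * y)].
pose R : set B := [set b | forall y, Q y -> Q (b * y)].
exists M => b; suff Rb : R b.
  have := Rb 1 _ [::]; rewrite big_nil mul1r mulr1; apply => s.
  by rewrite mulr1; apply: Pmon (leqnn _).
apply: (gen R) => [|j y Qy s]; last first.
  by have := Qy (j :: s); rewrite big_cons mulrA [X in P (X * y)]mulrC.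
apply: subalgI => [y|a u v Ru Rv y Qy s|u v Ru Rv y Qy].
- by rewrite mul1r.
- rewrite mulrDl mulrDr -scalerAl -scalerAr; apply: submodD => //; last exact: Rv.
  by apply: submodZ => //; apply: Ru.
- by rewrite -mulrA; apply: Ru; apply: Rv.
Qed.

(** A local slice [g] of [D] inverts [D g]: after multiplication by a power of
    [D g], every element is a polynomial in [g] over [ker D]. *)
Lemma slice_denominators D (g : B) C : [pchar k] =i pred0 ->
  is_derivation D -> locally_nilpotent D -> D (D g) = 0 ->
  GRing.subalg_closed (mem C) -> kernel D `<=` C -> C g ->
  forall b, exists N, C (D g ^+ N * b).
Proof.
move=> hk dD nD fD sC kC Cg b; have lD := der_lin dD.
have [C1 Cl CM] := subalgE sC; set f := D g in fD *.
have [n Dn] : exists n, iter n D b = 0 by have [n hn] := nD b; exists n; apply: hn.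
elim: n b Dn => [|n IH] b Dn.
  by exists 0%N; rewrite -[b]/(iter 0 D b) Dn mulr0; case: (submodE (subalg_submod sC)).
pose a := iter n D b; have Da : D a = 0 by [].
have fn0 : n`!%:R != 0 :> k.
  by rewrite (proj1 (pcharf0P k) hk) -lt0n fact_gt0.
have Df := der_kerX n dD fD.
(* [D^n] maps both terms to [f^n a], by [iter_slice]. *)
have [|N CN] := IH (f ^+ n * b - (n`!%:R : k)^-1 *: (g ^+ n * a)).
  rewrite (linB (lin_iter n lD)) (linZ (lin_iter n lD)) der_iterKM //.
  rewrite iter_slice // -/a -/f -mulrA mulr_natl -scaler_nat scalerA mulVf //.
  by rewrite scale1r subrr.
exists (N + n)%N.
have -> : f ^+ (N + n) * b = f ^+ N * (f ^+ n * b - (n`!%:R : k)^-1 *: (g ^+ n * a))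
    + (n`!%:R : k)^-1 *: (f ^+ N * (g ^+ n * a)).
  by rewrite mulrBr -scalerAr subrK exprD mulrA.
apply: submodD => //; first exact: subalg_submod.
apply: submodZ; first exact: subalg_submod.
apply: (CM); first by apply: subalgX => //; apply: kC.
by apply: CM; [apply: subalgX | apply: kC].
Qed.

End Denominators.

(** * A nonzero ideal in the algebra generated by the kernels *)

Section Conductor.
Context {k : fieldType} {B : kDomainType k}.
Variables (D U : B -> B).
Hypothesis hk : [pchar k] =i pred0.
Hypothesis DU : fundamental_pair D U.

Let dD : is_derivation D. Proof. by case: DU => [[]]. Qed.
Let dU : is_derivation U. Proof. by case: DU => _ []. Qed.

(** Starting from the top of a string, [U] runs through it backwards, up to
    nonzero scalars. *)
Lemma iterU_string n w i : lowest_weight D U n%:R w -> (i <= n)%N ->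
  exists2 l : k, l != 0 & iter i U (iter n D w) = l *: iter (n - i) D w.
Proof.
move=> hw; elim: i => [|i IH] ip.
  by exists 1; rewrite ?oner_neq0 // subn0 scale1r.
have [l l0 e] := IH (ltnW ip).
exists (l * ((n - i.+1).+1%:R * (n%:R - (n - i.+1)%:R))).
  rewrite natrB // opprB addrC subrK -natrM mulf_neq0 //.
  by rewrite (proj1 (pcharf0P k) hk).
rewrite iterS e (linZ (der_lin dU)) -scalerA; congr (_ *: _).
by rewrite -(subnSK ip); apply: U_iterD DU _ _ _ hw.
Qed.

(** [string_decomp] for finitely many vectors at once. *)
Lemma string_generators (s : seq B) :
  exists L : seq (nat * B),
    (forall x, x \in L -> lowest_weight D U x.1%:R x.2) /\
    (forall P : set B, GRing.submod_closed (mem P) ->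
       (forall x i, x \in L -> P (iter i D x.2)) -> forall b, b \in s -> P b).
Proof.
elim: s => [|b s [L [hL PL]]]; first by exists [::].
have [L1 [hL1 PL1]] := string_decomp DU hk b.
exists (L1 ++ L); split=> [x|P sP hP c].
  by rewrite mem_cat => /orP[/hL1|/hL].
rewrite inE => /orP[/eqP ->|cs].
  by apply: PL1 => // x i xL; apply: hP; rewrite mem_cat xL.
by apply: PL => // x i xL; apply: hP; rewrite mem_cat xL orbT.
Qed.

(** One power of [D g] multiplies [B] into any subalgebra that contains both
    kernels and the local slice [g]. *)
Lemma conductor_neq0 (haff : affine B) (C : set B) g :
  GRing.subalg_closed (mem C) -> kernel D `<=` C -> kernel U `<=` C -> C g ->
  D (D g) = 0 -> exists N, forall b, C (D g ^+ N * b).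
Proof.
move=> sC kD kU Cg Dg; case: haff => s gs.
have nD : locally_nilpotent D by case: DU => [[]].
have [L [hL PL]] := string_generators s.
pose K := (\max_(x <- L) x.1)%N.+1.
have LK x : x \in L -> (x.1 < K)%N.
  move=> xL; rewrite ltnS.
  by apply: (leq_bigmax_seq (F := fun x : nat * B => x.1)).
pose x_ (i : 'I_(size L)) := nth (0%N, 0) L i.
have x_L i : x_ i \in L by apply: mem_nth.
pose X (j : 'I_(size L) * 'I_K) := iter j.2 D (x_ j.1).2.
(* Squares make the rank strictly convex, so [i + i' = 2p] with [i <> p] gives
   a larger total rank than [2 p^2]. *)
apply: (bounded_denominators (X := X) (rk := fun j => (j.2 ^ 2)%N)) => //.
- exact: kD.
- by move=> j; apply: (slice_denominators hk dD).
- move=> [j p] P y sP CP HP; rewrite /X /=; set w := (x_ j).2; set n := (x_ j).1.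
  have hw : lowest_weight D U n%:R w by apply: hL.
  have nK : (n < K)%N by apply: LK.
  have XP i i' : (i <= n)%N -> (i' <= n)%N -> (i + i' = p.*2)%N -> i != p ->
      P (iter i D w * iter i' D w * y).
    move=> ni ni' ii' ip.
    have iK := leq_ltn_trans ni nK; have iK' := leq_ltn_trans ni' nK.
    apply: (HP (j, Ordinal iK) (j, Ordinal iK')) => /=.
    by move: ii' ip; clear; move: (p : nat) => {}p ii' ip; nia.
  have [np|pn] := ltnP n p.
    rewrite (iter0_le (der_lin dD) np (string_end DU hk hw)) !mul0r.
    by case: (submodE sP).
  have [np|np] := leqP n p.*2.
    apply: (string_square (n := n)) => //; first exact: (string_end DU hk hw).
    by move=> c c0; apply: CP; apply: kD.
  (* Left half of the string: run it backwards with [U] in place of [D]. *)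
  have [l l0 e] := iterU_string hw (leq_subr p n); rewrite subKn // in e.
  have : P (iter (n - p) U (iter n D w) * iter (n - p) U (iter n D w) * y).
    apply: (string_square (n := n)) => //.
    + have [l' _ /= ->] := iterU_string hw (leqnn n).
      by rewrite subnn /= (linZ (der_lin dU)) (proj1 hw) scaler0.
    + by rewrite -muln2; lia.
    + by move=> c c0; apply: CP; apply: kU.
    move=> i i' ni ni' ii' ip.
    have [m _ ->] := iterU_string hw ni; have [m' _ ->] := iterU_string hw ni'.
    rewrite -scalerAl -scalerAr scalerA -scalerAl; apply: submodZ => //.
    by apply: XP; lia.
  rewrite e -scalerAl -scalerAr scalerA -scalerAl => /(submodZ (l * l)^-1 sP).
  by rewrite scalerA mulVf ?scale1r // mulf_neq0.
- move=> R sR RX b; have : generated_subalgebra [set` s] b by rewrite gs.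
  apply: (smallest_sub (X := R)) => // c cs.
  apply: (PL R (subalg_submod sR)) => // x i xL.
  have sx : (index x L < size L)%N by rewrite index_mem.
  have [iK|Ki] := ltnP i K.
    by have := RX (Ordinal sx, Ordinal iK); rewrite /X /x_ /= nth_index.
  rewrite (iter0_le (der_lin dD) (leq_trans (LK _ xL) Ki) (string_end DU hk (hL _ xL))).
  by case: (submodE (subalg_submod sR)).
Qed.

Lemma kernels_ideal (haff : affine B) (S : set B) g :
  kernel D `<=` S -> kernel U `<=` S -> S g -> D (D g) = 0 -> D g != 0 ->
  exists I : set B, [/\ is_ideal I, (exists2 f, I f & f != 0)
    & I `<=` generated_subalgebra S].
Proof.
move=> kD kU Sg DDg Dg0; set C := generated_subalgebra S.
have SC : S `<=` C by apply: sub_smallest.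
have [||||N CN] := @conductor_neq0 haff C g _ _ _ _ DDg.
- exact: generated_subalgebra_closed.
- exact: subset_trans SC.
- exact: subset_trans SC.
- exact: SC.
exists [set D g ^+ N * b | b in setT]; split.
- split.
  + by exists 0; rewrite ?mulr0.
  + by move=> _ _ [b _ <-] [c _ <-]; exists (b + c) => //; rewrite mulrDr.
  + by move=> a _ [b _ <-]; exists (a * b) => //; rewrite mulrCA.
- by exists (D g ^+ N); [exists 1; rewrite ?mulr1 | exact: expf_neq0].
- by move=> _ [b _ <-]; apply: CN.
Qed.

End Conductor.

(** * Labelled trees *)

Section Star.
Variable n : nat.

(** The star whose [n.+1] leaves all point to the root [ord0]. *)
Definition star : rel 'I_n.+2 := [rel v w | (v != ord0) && (w == ord0)].

Lemma underlying_star v w : underlying star v w = ((v == ord0) != (w == ord0)).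
Proof. by rewrite /underlying /star /=; case: eqP; case: eqP. Qed.

Lemma star_in_tree : in_tree star ord0.
Proof.
split.
- by move=> v w /andP[v0 /eqP ->].
- have sym : connect_sym (underlying star).
    by apply: sym_connect_sym => v w; rewrite !underlying_star eq_sym.
  have r0 v : connect (underlying star) v ord0.
    have [->|v0] := eqVneq v ord0; first exact: connect0.
    by apply: connect1; rewrite underlying_star (negPf v0) eqxx.
  by move=> v w; apply: connect_trans (r0 v) _; rewrite sym.
- move=> [|x [|y [|z s]]] // /andP[cyc uni].
  move: cyc uni; rewrite /= !underlying_star.
  have [->|y0] := eqVneq y ord0.
    case: (eqVneq x ord0) => //= x0; case: (eqVneq z ord0) => //= z0.
    case: s => [|t s] /=; first by rewrite underlying_star (negPf x0) (negPf z0).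
    rewrite underlying_star (negPf z0); case: (eqVneq t ord0) => //= -> _.
    by rewrite !inE eqxx !orbT !andbF.
  case: (eqVneq x ord0) => //= ->; case: (eqVneq z ord0) => //= -> _.
  by rewrite !inE eqxx orbT.
- move=> v; have [->|v0] := eqVneq v ord0; first exact: connect0.
  by apply: connect1; rewrite /star /= v0 eqxx.
Qed.

End Star.

Section Compatible.
Context {k : fieldType} {B : kDomainType k}.
Variable n : nat.
Implicit Types theta : n.+2.-tuple (B -> B).

(** The condition on the label of an edge from [d] to [d']. *)
Definition edge_labels (d d' : B -> B) : set B :=
  (kernel (d \o d) `\` kernel d) `&` kernel d'.

Lemma compatible_star theta :
  (forall i, is_derivation (tnth theta i)) ->
  (exists I : set B, [/\ is_ideal I, (exists2 f, I f & f != 0)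
     & I `<=` generated_subalgebra
         (\bigcup_(i in [set: 'I_n.+2]) kernel (tnth theta i))]) ->
  injective (tnth theta) ->
  (forall i, i != ord0 -> exists x, edge_labels (tnth theta i) (thead theta) x) ->
  compatible theta.
Proof.
move=> der idl inj lab; split=> //.
have [eps heps] : exists eps : 'I_n.+2 -> B, forall i, i != ord0 ->
    edge_labels (tnth theta i) (thead theta) (eps i).
  apply: (@fin_all_exists _ (fun=> B)
    (fun i x => i != ord0 -> edge_labels (tnth theta i) (thead theta) x)) => i.
  have [->|i0] := eqVneq i ord0; first by exists 0.
  by have [x hx] := lab i i0; exists x.
exists 'I_n.+2, (@star n), ord0, (tnth theta), (fun v _ => eps v); split.
- exact: star_in_tree.
- split=> [i _|i j _ _ /inj //|_ [i _ <-]]; by exists i.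
- by [].
- by move=> v w /andP[v0 /eqP ->]; apply: heps.
Qed.

(** A tree with a vertex other than its root has an edge into the root. *)
Lemma compatible_edge theta i : compatible theta -> tnth theta i <> thead theta ->
  exists j x, tnth theta j <> thead theta /\
    edge_labels (tnth theta j) (thead theta) x.
Proof.
case=> _ _ [V [e [r [pi [eps [[asym _ _ conn] [fpi ipi spi] pir lab]]]]]] ri.
have [v _ pv] : (pi @` setT) (tnth theta i) by apply: spi; exists i.
have /connectP[p] := conn v.
case/lastP: p => [_ /= rv|p u]; first by case: ri; rewrite -pv -pir rv.
rewrite rcons_path last_rcons => /andP[_ eur] ru; rewrite -ru {u ru} in eur.
set u := last v p in eur.
have [j _ pj] : range (tnth theta) (pi u) by apply: fpi.
exists j, (eps u r); rewrite pj -pir; split; last exact: lab.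
move=> /ipi ur; have {}ur : u = r by apply: ur; rewrite in_setE.
have rr : e r r by rewrite -{1}ur.
by have := asym _ _ rr; rewrite rr.
Qed.

End Compatible.

(** * Compatibility and weights *)

Section Weights.
Context {k : fieldType} {B : kDomainType k}.
Variables (D U : B -> B).
Hypothesis hk : [pchar k] =i pred0.
Hypothesis DU : fundamental_pair D U.
Local Notation E := (lie D U).

Let dD : is_derivation D. Proof. by case: DU => [[]]. Qed.
Let dU : is_derivation U. Proof. by case: DU => _ []. Qed.
Let lD : linear D := der_lin dD.
Let lU : linear U := der_lin dU.
Let lE : linear E := lie_lin lD lU.
Let UD : fundamental_pair U D := fundamental_pair_sym DU.

Lemma natr_scale_eq0 n (v : B) : n.+1%:R *: v = 0 -> v = 0.
Proof.
by move/eqP; rewrite scaler_eq0 (proj1 (pcharf0P k) hk) => /eqP.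
Qed.

Lemma graded_neq0P d :
  graded_piece D U d <> [set 0] <-> exists2 f, graded_piece D U d f & f != 0.
Proof.
split=> [h|[f Af /eqP f0] h]; last by rewrite h in Af.
apply: contrapT => h'; apply: h; apply/seteqP; split=> f /=.
  by move=> Af; apply: contrapT => /eqP f0; apply: h'; exists f.
by move=> ->; split; rewrite ?(lin0 lE) ?scaler0 //; apply: lin0.
Qed.

Lemma graded_iterU d f : graded_piece D U d f -> iter d.+1 U f = 0.
Proof.
move=> [Df Ef]; apply: (string_end UD hk); split=> //.
by rewrite lie_sym Ef scaleNr.
Qed.

Lemma lie_neq_D : nontrivial_pair D U -> E <> D.
Proof.
move=> nt ED; have D0 f : D f = 0.
  have := lie_D DU f; rewrite ED -[LHS]addr0 => /addrI/esym.
  exact: natr_scale_eq0.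
apply: nt; split=> // f; have := lie_U DU f; rewrite ED !D0 (lin0 lU) sub0r.
by move/eqP; rewrite eq_sym oppr_eq0 => /eqP; apply: natr_scale_eq0.
Qed.

Lemma U_neq_D : nontrivial_pair D U -> U <> D.
Proof.
move=> nt e; have E0 f : E f = 0 by rewrite /lie e subrr.
have D0 f : D f = 0.
  have := lie_D DU f; rewrite !E0 (lin0 lD) add0r => /esym.
  exact: natr_scale_eq0.
by apply: nt; rewrite e; split.
Qed.

Lemma weight2_of_D g : E g = 0 -> D (D g) = 0 -> graded_piece D U 2 (D g).
Proof. by move=> Eg DDg; split=> //; rewrite (lie_D DU) Eg (lin0 lD) add0r. Qed.

(** Here [U g] is a lowest weight vector of weight [-2], so [D^2] takes it to a
    nonzero highest weight vector of weight [2]. *)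
Lemma weight2_of_U g : E g = 0 -> U (U g) = 0 -> U g != 0 ->
  exists2 f, graded_piece D U 2 f & f != 0.
Proof.
move=> Eg UUg Ug0; have hw : lowest_weight D U 2%:R (U g).
  by split=> //; rewrite (lie_U DU) Eg (lin0 lU) sub0r scaleNr.
exists (iter 2 D (U g)).
  split; first exact: (string_end DU hk hw).
  by rewrite (lie_iterD DU _ hw); congr (_ *: _); rewrite -natrB.
apply: contra_neq Ug0 => e; have := iterU_iterD DU 2 hw; rewrite e.
move/esym/eqP; rewrite (lin0 (lin_iter 2 lU)) scaler_eq0.
by rewrite (negPf (string_coef_neq0 hk (leqnn 2))) => /eqP.
Qed.

(** [D g = 0 = U^2 g] forces the weights of [g] to be [0] and [1], and [E g] is
    its component of weight [1]. *)
Lemma weight1_of_U g : D g = 0 -> U (U g) = 0 -> U g != 0 ->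
  exists2 f, graded_piece D U 1 f & f != 0.
Proof.
move=> Dg UUg Ug0.
have EUg : E (U g) = - U g.
  have := commute_iterU_D DU 1 g; rewrite /= Dg !(lin0 lU) UUg (lin0 lD) sub0r.
  move/esym/eqP; rewrite oppr_eq0 => /eqP/natr_scale_eq0/eqP.
  by rewrite scale1r addr_eq0 => /eqP.
have UEg : U (E g) = U g.
  have /eqP := lie_U DU g; rewrite EUg eq_sym subr_eq => /eqP ->.
  by rewrite scaler_nat mulr2n addrA addNr add0r.
have DEg : D (E g) = 0.
  by have := lie_D DU g; rewrite Dg (lin0 lE) scaler0 addr0.
exists (E g); last by apply: contra_neq Ug0 => Eg0; rewrite -UEg Eg0 (lin0 lU).
split=> //; rewrite scale1r {1}/lie UEg DEg (lin0 lU) subr0.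
by rewrite /lie Dg (lin0 lU) subr0.
Qed.

Lemma weight2_triple : affine B ->
  (exists2 f, graded_piece D U 2 f & f != 0) ->
  compatible [tuple E; D; U].
Proof.
move=> aff [f Af f0]; have [/= Df Ef] := Af.
have DUf : D (U f) = 2%:R *: f.
  by rewrite -[D _](subrK (U (D f))) -/(E f) Df (lin0 lU) addr0.
have DUf0 : D (U f) != 0.
  by rewrite DUf; apply: contra_neq f0; apply: natr_scale_eq0.
have DDUf : D (D (U f)) = 0 by rewrite DUf (linZ lD) Df scaler0.
have EUf : E (U f) = 0 by rewrite (lie_U DU) Ef (linZ lU) subrr.
have Uf0 : U f != 0 by apply: contra_neq DUf0 => ->; apply: lin0.
have UUf0 : U (U f) != 0.
  apply: contra_neq Uf0 => UUf; have := U_D D U (U f).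
  by rewrite UUf (lin0 lD) EUf subrr DUf (linZ lU) => /natr_scale_eq0.
have nED : E <> D by move=> e; rewrite -e EUf eqxx in DUf0.
have nEU : E <> U by move=> e; rewrite -{1}e EUf eqxx in UUf0.
have nDU : D <> U by move=> e; rewrite -e Df eqxx in Uf0.
apply: compatible_star.
- by case=> [[|[|[|i]]] //= hi] /=; rewrite (tnth_nth D) //=; apply: lie_derivation.
- apply: (kernels_ideal hk DU aff (g := U f)) => //.
  + by move=> v Dv; exists (lift ord0 ord0).
  + by move=> v Uv; exists (lift ord0 (lift ord0 ord0)).
  + by exists ord0.
- case=> [[|[|[|i]]] hi] // [[|[|[|j]]] hj] //; rewrite !(tnth_nth D) //= => e;
    by [exact: val_inj | have := esym e].
- have lab2 : edge_labels U E (U f).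
    by split=> //; split; [exact: (graded_iterU Af) | apply/eqP].
  have lab1 : edge_labels D E (U f) by split=> //; split=> //; apply/eqP.
  by case=> [[|[|[|i]]] hi] // _; exists (U f); rewrite (tnth_nth D).
Qed.

Lemma weight1_pair : affine B ->
  (exists2 f, graded_piece D U 1 f & f != 0) -> compatible [tuple D; U].
Proof.
move=> aff [f Af f0]; have [/= Df Ef] := Af.
have DUf : D (U f) = f.
  by rewrite -[D _](subrK (U (D f))) -/(E f) Df (lin0 lU) addr0 Ef scale1r.
have Uf0 : U f != 0 by apply: contra_neq f0 => Uf; rewrite -DUf Uf (lin0 lD).
have nDU : D <> U by move=> e; rewrite -e Df eqxx in Uf0.
have UUf : U (U f) = 0 by apply: (graded_iterU Af).
apply: compatible_star.
- by case=> [[|[|i]] //= hi] /=; rewrite (tnth_nth D).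
- apply: (kernels_ideal hk DU aff (g := U f)); rewrite ?DUf //.
  + by move=> v Dv; exists ord0.
  + by move=> v Uv; exists (lift ord0 ord0).
  + by exists (lift ord0 ord0).
- case=> [[|[|i]] hi] // [[|[|j]] hj] //; rewrite !(tnth_nth D) //= => e;
    by [exact: val_inj | have := esym e].
- case=> [[|[|i]] hi] // _; exists f; rewrite (tnth_nth D) //=.
  by split=> //; split=> //; apply/eqP.
Qed.

End Weights.

Theorem theorem1p4 (k : fieldType) (hk : [pchar k] =i pred0)
    (B : kDomainType k) (hnormal : normal_domain B) (haffine : affine B)
    (D U : B -> B) (hDU : fundamental_pair D U) (hnt : nontrivial_pair D U) :
  (compatible [tuple lie D U; D; U] <-> graded_piece D U 2 <> [set 0])
  /\
  (compatible [tuple D; U] <-> graded_piece D U 1 <> [set 0]).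
Proof.
split; rewrite (graded_neq0P hDU); split.
- move=> /(@compatible_edge _ _ _ _ (lift ord0 ord0)).
  rewrite /= => /(_ (fun e => lie_neq_D hk hDU hnt (esym e))).
  case=> -[[|[|[|i]]] hi] // [g]; rewrite (tnth_nth D) //= => -[//= _ [[gg g0] Eg]].
    by exists (D g); [exact: weight2_of_D | apply/eqP].
  by apply: (weight2_of_U hk hDU Eg gg); apply/eqP.
- exact: weight2_triple.
- move=> /(@compatible_edge _ _ _ _ (lift ord0 ord0)) /(_ (U_neq_D hk hDU hnt)).
  case=> -[[|[|i]] hi] // [g]; rewrite (tnth_nth D) //= => -[//= _ [[gg g0] Dg]].
  by apply: (weight1_of_U hk hDU Dg gg); apply/eqP.
- exact: weight1_pair.
Qed.
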